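(* For every $\rho\in[0,1)$ there is $c>0$ such that the following holds for every finite product probability space $(\Omega,\nu)=\prod_{i=1}^n(\Omega_i,\nu_i)$: if $f:\Omega\to\{0,1\}$ is $(\log(1/\mu),\mu^{1-c})$-global with $\mu\in(0,1/16)$, then ${\sf Stab}_\rho(f)\le\mu^{1+c}$.
   Context: The noise operator $\mathrm{T}_\rho$ acts by $(\mathrm{T}_\rho f)(x)=\mathbb{E}[f(\mathbf{y})]$, where independently for each $i$, $\mathbf{y}_i=x_i$ with probability $\rho$ and otherwise $\mathbf{y}_i$ is sampled from $\nu_i$. The noise stability is ${\sf Stab}_\rho(f)=\langle f,\mathrm{T}_\rho f\rangle=\mathbb{E}_{x\sim\nu}[f(x)(\mathrm{T}_\rho f)(x)]$. For $R\subset[n]$, $a\in\Omega_R$, $f_{R\to a}$ is the function on $\Omega_{[n]\setminus R}$ obtained by fixing the coordinates in $R$ to $a$; $f$ is $(r,\varepsilon)$-global if $\|f_{R\to a}\|_2^2\le\varepsilon$ for every $R$ with $|R|\le r$ and every $a\in\Omega_R$ (norms with respect to $\prod_{i\notin R}\nu_i$). *)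

(* Defs.v *)
From HB Require Import structures.
From mathcomp Require Import all_boot all_order all_algebra.
From mathcomp Require Import reals exp.
Set Implicit Arguments. Unset Strict Implicit. Unset Printing Implicit Defensive.
Import Order.TTheory GRing.Theory Num.Theory.
Local Open Scope ring_scope.

Section ProductSpace.
Variables (R : realType) (n : nat) (T : 'I_n -> finType).

Definition prodsp := {dffun forall i : 'I_n, T i}.

Definition is_prob_family (nu : forall i : 'I_n, T i -> R) : Prop :=
  forall i, (forall t, 0 <= nu i t) /\ \sum_(t : T i) nu i t = 1.

Definition prodw (nu : forall i : 'I_n, T i -> R) (x : prodsp) : R :=
  \prod_(i < n) nu i (x i).

Definition noise_kernel (nu : forall i : 'I_n, T i -> R) (rho : R)
    (x y : prodsp) : R :=
  \prod_(i < n) (rho * (x i == y i)%:R + (1 - rho) * nu i (y i)).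

Definition noiseT (nu : forall i : 'I_n, T i -> R) (rho : R)
    (f : prodsp -> R) (x : prodsp) : R :=
  \sum_(y : prodsp) noise_kernel nu rho x y * f y.

Definition Stab (nu : forall i : 'I_n, T i -> R) (rho : R)
    (f : prodsp -> R) : R :=
  \sum_(x : prodsp) prodw nu x * (f x * noiseT nu rho f x).

(* || f_{S -> a} ||_2^2, the norm w.r.t. prod_{i notin S} nu_i of the
   restriction of f obtained by fixing the coordinates in S to a.
   The point a \in Omega_S is given by any a : Omega (only its
   coordinates in S matter); the restricted function is evaluated on the
   points y of Omega agreeing with a on S. *)
Definition restr_norm2 (nu : forall i : 'I_n, T i -> R) (f : prodsp -> R)
    (S : {set 'I_n}) (a : prodsp) : R :=
  \sum_(y : prodsp | [forall i in S, y i == a i])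
     (\prod_(i < n | i \notin S) nu i (y i)) * f y ^+ 2.

Definition is_global (nu : forall i : 'I_n, T i -> R) (r eps : R)
    (f : prodsp -> R) : Prop :=
  forall (S : {set 'I_n}), (#|S|%:R <= r) ->
    forall a : prodsp, restr_norm2 nu f S a <= eps.

End ProductSpace.

(* Main.v *)
(** A Boolean function whose restrictions to at most [ln (1 / mu)] coordinates
    have squared norm at most [eps = mu ^ (1 - c)] satisfies the bound
    [e ^ #|S| * eps] for restrictions to every set [S], since these norms never
    exceed 1.  For small noise rate, multiplication by [T f] is then bounded on
    the image of [T]: [E ((T f)^2 (T g)^2) <= eps * E (g^2)].  This is proved
    coordinate by coordinate, splitting both functions into their mean and
    deviation at one coordinate: by AM-GM only the squares of the four products
    survive, the only one not covered by [eps] itself is the product of the two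
    deviations, and there the deviation of [f] satisfies the restriction bound
    up to a constant factor, which the coefficient of order [rho ^ 4] pays
    for.  Taking [g = f] gives [E (T f)^4 <= eps^2], hence [Stab f ^ 4 <= eps^5]
    by Cauchy-Schwarz.  A general [rho] is reduced to small noise by iterating
    [(Stab_rho f)^2 <= E (f^2) * Stab_(rho^2) f]. *)
Require Import Defs.
From HB Require Import structures.
From mathcomp Require Import all_boot all_order all_algebra.
From mathcomp Require Import reals exp.
From mathcomp Require Import boolp sequences ring lra.
Import Order.TTheory GRing.Theory Num.Theory.
Local Open Scope ring_scope.

(** * Commuting operators acting on single coordinates *)

Section CoordinateKernels.
Context {R : realType} {n : nat} {T : 'I_n -> finType}.
Implicit Types (x y : prodsp T) (i j : 'I_n) (s : seq 'I_n).

Definition upd x i (t : T i) : prodsp T := [ffun j => dfwith x t j].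

Lemma upd_in x i (t : T i) : upd x i t i = t.
Proof. by rewrite ffunE dfwith_in. Qed.

Lemma upd_out x i (t : T i) j : j != i -> upd x i t j = x j.
Proof. by move=> ji; rewrite ffunE dfwith_out // eq_sym. Qed.

Lemma upd_id x i : upd x i (x i) = x.
Proof.
apply/ffunP => j; have [->|ji] := eqVneq j i; first by rewrite upd_in.
by rewrite upd_out.
Qed.

Lemma upd_upd x i (t u : T i) : upd (upd x i t) i u = upd x i u.
Proof.
apply/ffunP => j; have [->|ji] := eqVneq j i; first by rewrite !upd_in.
by rewrite !upd_out.
Qed.

Lemma updC x i j (t : T i) (u : T j) : i != j ->
  upd (upd x i t) j u = upd (upd x j u) i t.
Proof.
move=> ij; apply/ffunP => k; have [->|ki] := eqVneq k i.
  by rewrite upd_in upd_out // upd_in.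
rewrite (upd_out _ _ _ _ ki); have [->|kj] := eqVneq k j; first by rewrite !upd_in.
by rewrite !upd_out.
Qed.

(** [k i a t] is the weight for moving coordinate [i] from [a] to [t]. Expectation ([kE]) and noise
    ([kT]) are both of this form, so one calculus serves both. *)
Definition kernel := forall i : 'I_n, T i -> T i -> R.
Implicit Types (k l : kernel) (f g : prodsp T -> R).

Definition cop k i f : prodsp T -> R :=
  fun x => \sum_(t : T i) k i (x i) t * f (upd x i t).

Definition opseq k s f : prodsp T -> R := foldr (cop k) f s.

(** The weights at [i] read only coordinate [i], which the operator at [j] leaves alone, so the
    claim is an exchange of two finite sums. *)
Lemma copC k l i j f : i != j -> cop k i (cop l j f) = cop l j (cop k i f).
Proof.
move=> ij; apply/funext => x; rewrite /cop.
under eq_bigr do rewrite mulr_sumr.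
rewrite exchange_big /=; apply: eq_bigr => u _; rewrite mulr_sumr.
apply: eq_bigr => t _; rewrite !upd_out // 1?eq_sym // (updC _ _ _ _ _ ij); ring.
Qed.

Lemma cop_opseq k l i s f : i \notin s ->
  cop k i (opseq l s f) = opseq l s (cop k i f).
Proof.
elim: s => //= j s IH; rewrite inE negb_or => /andP[ij /IH <-].
by rewrite copC.
Qed.

Lemma opseq_upd k i s f x (t : T i) : i \notin s ->
  opseq k s f (upd x i t) = opseq k s (fun y => f (upd y i t)) x.
Proof.
elim: s x => //= j s IH x; rewrite inE negb_or => /andP[ij si].
apply: eq_bigr => u _; rewrite upd_out 1?eq_sym //; congr (_ * _).
by rewrite updC // IH.
Qed.

Lemma opseqD k s f g :
  opseq k s (fun x => f x + g x) = (fun x => opseq k s f x + opseq k s g x).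
Proof.
elim: s => //= i s ->; apply/funext => x; rewrite /cop -big_split /=.
by apply: eq_bigr => t _; rewrite mulrDr.
Qed.

Lemma opseqZ k s (a : R) f :
  opseq k s (fun x => a * f x) = (fun x => a * opseq k s f x).
Proof.
elim: s => //= i s ->; apply/funext => x; rewrite /cop mulr_sumr.
by apply: eq_bigr => t _; rewrite mulrCA.
Qed.

Lemma opseqB k s f g :
  opseq k s (fun x => f x - g x) = (fun x => opseq k s f x - opseq k s g x).
Proof.
have -> : (fun x => f x - g x) = (fun x => f x + -1 * g x).
  by apply/funext => x; rewrite mulN1r.
by rewrite opseqD opseqZ; apply/funext => x; rewrite mulN1r.
Qed.

Lemma opseq_sum k s (J : finType) (f : J -> prodsp T -> R) :
  opseq k s (fun x => \sum_j f j x) = (fun x => \sum_j opseq k s (f j) x).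
Proof.
elim: s => //= i s ->; apply/funext => x; rewrite /cop exchange_big /=.
by apply: eq_bigr => t _; rewrite mulr_sumr.
Qed.

Lemma cop_sum k i (J : finType) (w : J -> R) (f : J -> prodsp T -> R) x :
  cop k i (fun x => \sum_j w j * f j x) x = \sum_j w j * cop k i (f j) x.
Proof.
rewrite /cop; under eq_bigr do rewrite mulr_sumr.
rewrite exchange_big /=; apply: eq_bigr => j _; rewrite mulr_sumr.
by apply: eq_bigr => t _; rewrite mulrCA.
Qed.

Lemma cop_linear k i (a b : R) f g x :
  cop k i (fun x => a * f x + b * g x) x = a * cop k i f x + b * cop k i g x.
Proof.
rewrite /cop !mulr_sumr -big_split /=; apply: eq_bigr => t _; ring.
Qed.

Definition kernel_ge0 k := forall i a t, 0 <= k i a t.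

Lemma le_opseq k s f g : kernel_ge0 k -> (forall x, f x <= g x) ->
  forall x, opseq k s f x <= opseq k s g x.
Proof.
move=> k0 fg; elim: s => //= i s IH x; apply: ler_sum => t _.
exact: ler_wpM2l.
Qed.

Lemma opseq_ge0 k s f : kernel_ge0 k -> (forall x, 0 <= f x) ->
  forall x, 0 <= opseq k s f x.
Proof.
move=> k0 f0; elim: s => //= i s IH x; apply: sumr_ge0 => t _.
exact: mulr_ge0.
Qed.

(** Link between the iterated operators and the global sums in [prodw], [noiseT] and [restr_norm2].
    The induction sorts the points [y] by their value at the head coordinate. *)
Lemma opseqE k s f x : uniq s ->
  opseq k s f x = \sum_(y : prodsp T | [forall i, (i \notin s) ==> (y i == x i)])
    (\prod_(i <- s) k i (x i) (y i)) * f y.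
Proof.
elim: s x => [x _|i s IH x /= /andP[si us]] /=.
  rewrite (big_pred1 x) => [|y]; first by rewrite big_nil mul1r.
  apply/forallP/eqP => [yx|-> i] //; apply/ffunP => i; exact/eqP/(yx i).
rewrite /cop (partition_big (fun y : prodsp T => y i) predT) //=.
apply: eq_bigr => t _; rewrite IH // mulr_sumr.
have E y : [forall j, (j \notin s) ==> (y j == upd x i t j)] =
   [forall j, (j \notin i :: s) ==> (y j == x j)] && (y i == t).
  apply/forallP/andP => [yx|[/forallP yx /eqP yi] j].
    split; last by have := yx i; rewrite si upd_in.
    apply/forallP => j; apply/implyP; rewrite inE negb_or => /andP[ji js].
    by have := yx j; rewrite js upd_out.
  apply/implyP => js; have [->|ji] := eqVneq j i; first by rewrite upd_in yi.
  by have := yx j; rewrite inE negb_or ji js upd_out.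
rewrite (eq_bigl _ _ E); apply: eq_bigr => y /andP[_ /eqP yi].
rewrite big_cons yi mulrA; congr (_ * _ * _).
rewrite !big_seq; apply: eq_bigr => j js; rewrite upd_out //.
by apply: contraNneq si => <-.
Qed.

End CoordinateKernels.

(** * The inequality in one coordinate *)

Lemma one_coordinate_bound (R : realType) (I : finType) (p u v : I -> R) (rho : R) :
  (forall t, 0 <= p t) -> \sum_t p t = 1 -> rho ^+ 2 <= 1 / 8 ->
  forall a c, a = \sum_t p t * u t -> c = \sum_t p t * v t ->
  \sum_t p t * ((a + rho * (u t - a)) ^+ 2 * (c + rho * (v t - c)) ^+ 2) <=
  (\sum_t p t * u t ^+ 2) * c ^+ 2
  + (\sum_t p t / 2 * (a ^+ 2 * (v t - c) ^+ 2)
  + \sum_t 3 * rho ^+ 4 * p t * ((u t - a) ^+ 2 * (v t - c) ^+ 2)).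
Proof.
move=> p0 p1 hr a c ha hc.
have mean0 (h : I -> R) m : m = \sum_t p t * h t -> \sum_t p t * (h t - m) = 0.
  move=> hm; under eq_bigr do rewrite mulrBr.
  by rewrite sumrB -mulr_suml p1 mul1r hm subrr.
(* The two added terms are linear in the deviations and have mean zero. They absorb the linear terms
   of the product, so that the comparison holds for each [t] separately. *)
have -> : (\sum_t p t * u t ^+ 2) * c ^+ 2
  + (\sum_t p t / 2 * (a ^+ 2 * (v t - c) ^+ 2)
  + \sum_t 3 * rho ^+ 4 * p t * ((u t - a) ^+ 2 * (v t - c) ^+ 2)) =
  \sum_t p t * (u t ^+ 2 * c ^+ 2 + a ^+ 2 * (v t - c) ^+ 2 / 2
    + 3 * rho ^+ 4 * ((u t - a) ^+ 2 * (v t - c) ^+ 2)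
    + (2 * rho - 2) * a * c ^+ 2 * (u t - a) + 2 * rho * a ^+ 2 * c * (v t - c)).
  transitivity ((\sum_t p t * u t ^+ 2) * c ^+ 2
  + (\sum_t p t / 2 * (a ^+ 2 * (v t - c) ^+ 2)
  + \sum_t 3 * rho ^+ 4 * p t * ((u t - a) ^+ 2 * (v t - c) ^+ 2))
  + (\sum_t p t * (u t - a)) * ((2 * rho - 2) * a * c ^+ 2)
  + (\sum_t p t * (v t - c)) * (2 * rho * a ^+ 2 * c)).
    by rewrite (mean0 u) // (mean0 v) //; ring.
  rewrite !mulr_suml -!big_split /=; by apply: eq_bigr => t _; field.
apply: ler_sum => t _; apply: ler_wpM2l => //.
set b := u t - a; set d := v t - c.
have -> : u t = a + b by rewrite /b addrC subrK.
rewrite -subr_ge0.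
(* The difference is a combination of squares; nonnegativity of the coefficient
   [1 / 2 - 4 * rho ^+ 2] is exactly the condition [rho ^+ 2 <= 1 / 8]. *)
have -> : (a + b) ^+ 2 * c ^+ 2 + a ^+ 2 * d ^+ 2 / 2 +
   3 * rho ^+ 4 * (b ^+ 2 * d ^+ 2) + (2 * rho - 2) * a * c ^+ 2 * b +
   2 * rho * a ^+ 2 * c * d - (a + rho * b) ^+ 2 * (c + rho * d) ^+ 2 =
   (1 - 4 * rho ^+ 2) * (c * b) ^+ 2 + (1 / 2 - 4 * rho ^+ 2) * (a * d) ^+ 2
   + 2 * (rho * (a * d - c * b)) ^+ 2 + (rho * (a * d - rho * b * d)) ^+ 2
   + (rho * (c * b - rho * b * d)) ^+ 2 by field.
have h1 : 0 <= 1 - 4 * rho ^+ 2 by lra.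
have h2 : 0 <= 1 / 2 - 4 * rho ^+ 2 by lra.
by do 4 ?apply: addr_ge0; rewrite ?sqr_ge0 // mulr_ge0 ?sqr_ge0.
Qed.

(** * Restriction bounds and the noise inequality on the product space *)

Section ProductMeasure.
Context {R : realType} {n : nat} {T : 'I_n -> finType}.
Variable nu : forall i : 'I_n, T i -> R.
Implicit Types (x y : prodsp T) (i : 'I_n) (s : seq 'I_n) (f g : prodsp T -> R).

Definition kE : @kernel R n T := fun i _ t => nu i t.

Definition kT (rho : R) : @kernel R n T :=
  fun i a t => rho * (a == t)%:R + (1 - rho) * nu i t.

Lemma cop_kT rho i f :
  cop (kT rho) i f = fun x => rho * f x + (1 - rho) * cop kE i f x.
Proof.
apply/funext => x; rewrite /cop /kT /kE.
rewrite (eq_bigr (fun t => rho * ((x i == t)%:R * f (upd x i t)) +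
    (1 - rho) * (nu i t * f (upd x i t)))); last by move=> t _; ring.
rewrite big_split -!mulr_sumr /= (bigD1 (x i)) //= eqxx mul1r upd_id.
rewrite [X in rho * (_ + X)]big1 ?addr0 // => t tx.
by rewrite eq_sym (negPf tx) mul0r.
Qed.

Lemma cop_kE_upd i f x (t : T i) : cop kE i f (upd x i t) = cop kE i f x.
Proof. by apply: eq_bigr => u _; rewrite upd_upd. Qed.

Hypothesis hnu : is_prob_family nu.

Lemma kE_ge0 : kernel_ge0 kE.
Proof. by move=> i a t; rewrite /kE; case: (hnu i). Qed.

Lemma kT_ge0 rho : 0 <= rho -> rho <= 1 -> kernel_ge0 (kT rho).
Proof.
move=> r0 r1 i a t; case: (hnu i) => h _.
by rewrite /kT addr_ge0 ?mulr_ge0 ?ler0n ?subr_ge0.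
Qed.

Lemma cop_kE_indep i f x : (forall t, f (upd x i t) = f x) -> cop kE i f x = f x.
Proof.
move=> fx; rewrite /cop; under eq_bigr do rewrite fx.
by rewrite -mulr_suml; case: (hnu i) => _ ->; rewrite mul1r.
Qed.

Lemma variance_decomposition i f x :
  cop kE i f x ^+ 2 + \sum_t nu i t * (f (upd x i t) - cop kE i f x) ^+ 2 =
  cop kE i (fun y => f y ^+ 2) x.
Proof.
set a := cop kE i f x.
have -> : \sum_t nu i t * (f (upd x i t) - a) ^+ 2 =
  \sum_t nu i t * f (upd x i t) ^+ 2 + (\sum_t nu i t * f (upd x i t)) * (- 2 * a)
  + (\sum_t nu i t) * a ^+ 2.
  rewrite !mulr_suml -!big_split /=; apply: eq_bigr => t _; ring.
case: (hnu i) => _ ->; rewrite /cop -/kE.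
have -> : \sum_t nu i t * f (upd x i t) = a by [].
rewrite /kE; ring.
Qed.

Lemma sqr_mean_le i f x : cop kE i f x ^+ 2 <= cop kE i (fun y => f y ^+ 2) x.
Proof.
rewrite -variance_decomposition lerDl sumr_ge0 // => t _.
by rewrite mulr_ge0 ?sqr_ge0 //; case: (hnu i).
Qed.

(** Coordinates in [s1] are averaged, the others are fixed by [x]. The exponent counts only the
    fixed ones in [s]; those outside [s] are free parameters, which lets an induction consume
    [s]. *)
Definition restr_bounded (K : R) s f (G : R) := forall s1, subseq s1 s ->
  forall x, opseq kE s1 f x <= K ^+ (size s - size s1) * G.

Lemma restr_bounded_le K s f g G : (forall x, f x <= g x) ->
  restr_bounded K s g G -> restr_bounded K s f G.
Proof.
move=> fg H s1 s1s x; apply: le_trans (H s1 s1s x).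
by apply: le_opseq => //; exact: kE_ge0.
Qed.

Lemma restr_bounded_lin K s f g (a F G : R) : 0 <= a ->
  restr_bounded K s f F -> restr_bounded K s g G ->
  restr_bounded K s (fun x => a * f x + a * g x) (a * (F + G)).
Proof.
move=> a0 Hf Hg s1 s1s x; rewrite opseqD !opseqZ -mulrDr mulrCA.
by rewrite ler_wpM2l // mulrDr lerD ?Hf ?Hg.
Qed.

Lemma restr_bounded_mean K i s f G : i \notin s -> restr_bounded K (i :: s) f G ->
  restr_bounded K s (cop kE i f) G.
Proof.
move=> si H s1 s1s x; have := H (i :: s1); rewrite /= eqxx => /(_ s1s x).
rewrite subSS cop_opseq //; apply: contra si; exact: mem_subseq.
Qed.

(** Fixing the head coordinate is one more restriction and costs one factor [K], whereas averaging
    over it costs nothing. *)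
Lemma restr_bounded_upd K i s f G (t : T i) : i \notin s ->
  restr_bounded K (i :: s) f G ->
  restr_bounded K s (fun x => f (upd x i t)) (K * G).
Proof.
move=> si H s1 s1s x; rewrite -opseq_upd; last by apply: contra si; exact: mem_subseq.
have := H s1 (subseq_trans s1s (subseq_cons _ _)) (upd x i t).
by rewrite /= subSn ?size_subseq // exprSr mulrA.
Qed.

Lemma opseq_kT_dev rho i s f y (t : T i) : i \notin s ->
  opseq (kT rho) s (fun z => f (upd z i t) - cop kE i f z) y =
  opseq (kT rho) s f (upd y i t) - cop kE i (opseq (kT rho) s f) y.
Proof. by move=> si; rewrite opseqB opseq_upd // cop_opseq. Qed.

(* Working with a weighted family [f j] instead of one function makes the
   statement stable under peeling off a coordinate: the restrictions of [f] at
   that coordinate become a new family, indexed by [J * T i]. *)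
Lemma noise_product_bound (K rho : R) : 0 <= K -> rho ^+ 2 <= 1 / 8 ->
  12 * (K + 1) * rho ^+ 4 <= 1 -> forall s, uniq s ->
  forall (J : finType) (w : J -> R) (f : J -> prodsp T -> R) g (G : R),
  (forall j, 0 <= w j) ->
  restr_bounded K s (fun x => \sum_j w j * f j x ^+ 2) G ->
  forall x, opseq kE s (fun y => \sum_j w j *
    (opseq (kT rho) s (f j) y ^+ 2 * opseq (kT rho) s g y ^+ 2)) x <=
    G * opseq kE s (fun y => g y ^+ 2) x.
Proof.
move=> K0 hr hK; elim => [_ J w f g G w0 H x /=|i s IH /= /andP[si us] J w f g G w0 H x].
  have /= := H [::] isT x; rewrite mul1r => /(ler_wpM2r (sqr_ge0 (g x))).
  by apply: le_trans; rewrite mulr_suml ler_sum // => j _; rewrite mulrA.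
have nu0 t : 0 <= nu i t by case: (hnu i).
have nu1 : \sum_t nu i t = 1 by case: (hnu i).
pose S h := opseq (kT rho) s h.
pose dev h (t : T i) := fun z => h (upd z i t) - cop kE i h z.
(* [b1], [b2], [b3] correspond to the three sums on the right of [one_coordinate_bound]:
   restrictions of [f] against the mean of [g], mean against deviation, and deviation against
   deviation. *)
pose b1 y := \sum_(jt : J * T i) w jt.1 * nu i jt.2 *
  (S (fun z => f jt.1 (upd z i jt.2)) y ^+ 2 * S (cop kE i g) y ^+ 2).
pose b2 t y := \sum_j w j * (S (cop kE i (f j)) y ^+ 2 * S (dev g t) y ^+ 2).
pose b3 t y := \sum_j w j * (S (dev (f j) t) y ^+ 2 * S (dev g t) y ^+ 2).
have G0 : 0 <= G.
  have := H _ (subseq_refl _) x; rewrite subnn mul1r; apply: le_trans.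
  apply: opseq_ge0; first exact: kE_ge0.
  by move=> y; apply: sumr_ge0 => j _; rewrite mulr_ge0 ?sqr_ge0.
have Hmean : restr_bounded K s (fun y => \sum_j w j * cop kE i (f j) y ^+ 2) G.
  apply: restr_bounded_le (restr_bounded_mean _ _ _ _ _ si H) => y.
  have -> : cop kE i (fun z => \sum_j w j * f j z ^+ 2) y =
     \sum_j w j * cop kE i (fun z => f j z ^+ 2) y.
    by rewrite cop_sum.
  by apply: ler_sum => j _; rewrite ler_wpM2l // sqr_mean_le.
have step y : cop kE i (fun y => \sum_j w j * (cop (kT rho) i (S (f j)) y ^+ 2 *
    cop (kT rho) i (S g) y ^+ 2)) y <=
  b1 y + (\sum_t nu i t / 2 * b2 t y + \sum_t 3 * rho ^+ 4 * nu i t * b3 t y).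
  have -> : cop kE i (fun y => \sum_j w j * (cop (kT rho) i (S (f j)) y ^+ 2 *
      cop (kT rho) i (S g) y ^+ 2)) y = \sum_j w j * \sum_t nu i t *
    ((cop kE i (S (f j)) y + rho * (S (f j) (upd y i t) - cop kE i (S (f j)) y)) ^+ 2 *
     (cop kE i (S g) y + rho * (S g (upd y i t) - cop kE i (S g) y)) ^+ 2).
    rewrite cop_sum; apply: eq_bigr => j _; rewrite {1}/cop; congr (_ * _); apply: eq_bigr => t _.
    (* Noise at [i] keeps the mean and multiplies the deviation by [rho]. *)
    rewrite !cop_kT !cop_kE_upd; congr (_ * (_ ^+ 2 * _ ^+ 2)); ring.
  have -> : b1 y + (\sum_t nu i t / 2 * b2 t y + \sum_t 3 * rho ^+ 4 * nu i t * b3 t y) =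
    \sum_j w j * ((\sum_t nu i t * S (f j) (upd y i t) ^+ 2) * cop kE i (S g) y ^+ 2
    + (\sum_t nu i t / 2 * (cop kE i (S (f j)) y ^+ 2 * (S g (upd y i t) - cop kE i (S g) y) ^+ 2)
    + \sum_t 3 * rho ^+ 4 * nu i t * ((S (f j) (upd y i t) - cop kE i (S (f j)) y) ^+ 2 *
       (S g (upd y i t) - cop kE i (S g) y) ^+ 2))).
    under [RHS]eq_bigr do rewrite !mulrDr.
    rewrite !big_split /=; congr (_ + (_ + _)).
    - rewrite /b1 -(pair_bigA _ (fun j t => w j * nu i t *
        (S (fun z => f j (upd z i t)) y ^+ 2 * S (cop kE i g) y ^+ 2))) /=.
      apply: eq_bigr => j _; rewrite mulr_suml mulr_sumr; apply: eq_bigr => t _.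
      rewrite /S opseq_upd // cop_opseq //; ring.
    - under eq_bigr do rewrite mulr_sumr.
      rewrite exchange_big /=; apply: eq_bigr => j _; rewrite mulr_sumr.
      apply: eq_bigr => t _; rewrite /S /dev opseq_kT_dev // -cop_opseq //; ring.
    - under eq_bigr do rewrite mulr_sumr.
      rewrite exchange_big /=; apply: eq_bigr => j _; rewrite mulr_sumr.
      apply: eq_bigr => t _; rewrite /S /dev !opseq_kT_dev //; ring.
  apply: ler_sum => j _; apply: ler_wpM2l => //.
  exact: one_coordinate_bound.
have B1 : opseq kE s b1 x <= G * opseq kE s (fun y => cop kE i g y ^+ 2) x.
  (* Averaged with weights [nu i t], the restricted family is the mean over coordinate [i], so the
     constant stays [G]. *)
  apply: (IH us _ (fun jt : J * T i => w jt.1 * nu i jt.2)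
    (fun jt z => f jt.1 (upd z i jt.2))) => [[j t]|]; first by rewrite mulr_ge0.
  apply: restr_bounded_le (restr_bounded_mean _ _ _ _ _ si H) => y.
  rewrite -(pair_bigA _ (fun j t => w j * nu i t * f j (upd y i t) ^+ 2)) /=.
  rewrite exchange_big /= le_eqVlt; apply/orP; left; apply/eqP.
  apply: eq_bigr => t _; rewrite mulr_sumr; apply: eq_bigr => j _.
  by rewrite /kE; ring.
have B2 t : opseq kE s (b2 t) x <= G * opseq kE s (fun y => dev g t y ^+ 2) x.
  exact: (IH us).
have B3 t : opseq kE s (b3 t) x <=
    (2 * (K * G + G)) * opseq kE s (fun y => dev g t y ^+ 2) x.
  apply: (IH us) => //.
  (* From [(u - a) ^+ 2 <= 2 * u ^+ 2 + 2 * a ^+ 2]: the restriction contributes [K * G] and the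
     mean contributes [G]. *)
  apply: restr_bounded_le (restr_bounded_lin _ _ _ _ _ _ _ _
    (restr_bounded_upd _ _ _ _ _ t si H) Hmean) => // y.
  rewrite !mulr_sumr -big_split /=; apply: ler_sum => j _.
  rewrite -subr_ge0 /dev.
  have -> : 2 * (w j * f j (upd y i t) ^+ 2) + 2 * (w j * cop kE i (f j) y ^+ 2) -
    w j * (f j (upd y i t) - cop kE i (f j) y) ^+ 2 =
    w j * (f j (upd y i t) + cop kE i (f j) y) ^+ 2 by ring.
  by rewrite mulr_ge0 ?sqr_ge0.
rewrite !(cop_opseq kE kE) //.
apply: (le_trans (le_opseq kE s _ _ kE_ge0 step x)).
have -> : cop kE i (fun y => g y ^+ 2) =
  fun y => cop kE i g y ^+ 2 + \sum_t nu i t * dev g t y ^+ 2.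
  by apply/funext => y; rewrite -variance_decomposition.
rewrite !opseqD mulrDr lerD // !opseq_sum.
rewrite mulr_sumr -big_split /=; apply: ler_sum => t _; rewrite !opseqZ.
have := B3 t; have := B2 t; set D := opseq kE s (fun y => dev g t y ^+ 2) x => B2t B3t.
have D0 : 0 <= D by apply: opseq_ge0 => [|y]; [exact: kE_ge0|rewrite /= sqr_ge0].
have r4 : 0 <= rho ^+ 4 by rewrite -[4%N]/(2 * 2)%N exprM sqr_ge0.
have c2 : 0 <= nu i t / 2 by rewrite divr_ge0.
have c3 : 0 <= 3 * rho ^+ 4 * nu i t by rewrite mulr_ge0 // mulr_ge0.
apply: le_trans (lerD (ler_wpM2l c2 B2t) (ler_wpM2l c3 B3t)) _.
(* The deviations of [g] cost [1 / 2 + 6 * (K + 1) * rho ^+ 4] times [G]; this is at most [G] by the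
   hypothesis with constant 12. *)
rewrite -subr_ge0.
have -> : G * (nu i t * D) - (nu i t / 2 * (G * D) +
   3 * rho ^+ 4 * nu i t * (2 * (K * G + G) * D)) =
   (1 - 12 * (K + 1) * rho ^+ 4) * (G * nu i t * D) / 2 by field.
by rewrite divr_ge0 // !mulr_ge0 // subr_ge0.
Qed.

End ProductMeasure.

(** * Cauchy-Schwarz and decay of powers *)

Lemma weighted_cauchy_schwarz (R : realFieldType) (I : finType) (p u v : I -> R) :
  (forall x, 0 <= p x) -> (\sum_x p x * (u x * v x)) ^+ 2 <=
  (\sum_x p x * u x ^+ 2) * (\sum_x p x * v x ^+ 2).
Proof.
move=> p0; set C := \sum_x _; set A := \sum_x _; set B := \sum_x _.
have H t : 0 <= A + 2 * t * C + t ^+ 2 * B.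
  have -> : A + 2 * t * C + t ^+ 2 * B = \sum_x p x * (u x + t * v x) ^+ 2.
    rewrite /A /B /C !mulr_sumr -!big_split /=; apply: eq_bigr => x _; ring.
  by apply: sumr_ge0 => x _; rewrite mulr_ge0 ?sqr_ge0.
have B0 : 0 <= B by apply: sumr_ge0 => x _; rewrite mulr_ge0 ?sqr_ge0.
have [B1|B1] := eqVneq B 0.
  have [->|C0] := eqVneq C 0; first by rewrite B1 mulr0 expr0n.
  (* With [B = 0] the quadratic is affine in [t]; this [t] would give it the value -1. *)
  have := H (- (A + 1) / (2 * C)).
  have -> : A + 2 * (- (A + 1) / (2 * C)) * C + (- (A + 1) / (2 * C)) ^+ 2 * B = -1.
    by rewrite B1; field.
  by rewrite oppr_ge0 ler10.
have Bp : 0 < B by rewrite lt_def B1.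
(* The minimiser of the quadratic. *)
have := H (- C / B).
have -> : A + 2 * (- C / B) * C + (- C / B) ^+ 2 * B = (A * B - C ^+ 2) / B by field.
by rewrite pmulr_lge0 ?invr_gt0 // subr_ge0.
Qed.

Lemma small_power_of_two_power (R : realType) (rho delta : R) :
  0 <= rho -> rho < 1 -> 0 < delta -> exists m, rho ^+ (2 ^ m) <= delta.
Proof.
move=> r0 r1 d0; have r1' : 0 < 1 - rho by rewrite subr_gt0.
have X0 k : 0 <= rho ^+ k by rewrite exprn_ge0.
set m := Num.bound ((1 - rho) * delta)^-1; exists m; set M := (2 ^ m)%N.
have hM : ((1 - rho) * delta)^-1 < M%:R.
  have h : ((1 - rho) * delta)^-1 < m%:R.
    by rewrite archi_boundP // invr_ge0 mulr_ge0 ?ltW.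
  by apply: lt_le_trans h _; rewrite ler_nat ltnW // ltn_expl.
(* Each of the [M] terms of the geometric sum is at least [rho ^+ M], and the sum times [1 - rho] is
   [1 - rho ^+ M]. *)
have bernoulli : (1 - rho) * (M%:R * rho ^+ M) <= 1.
  have le_sum : M%:R * rho ^+ M <= \sum_(i < M) rho ^+ i.
    have -> : M%:R * rho ^+ M = \sum_(i < M) rho ^+ M.
      by rewrite sumr_const card_ord mulr_natl.
    apply: ler_sum => i _.
    by apply: ler_wiXn2l => //; first [exact: ltW | exact: ltnW].
  apply: le_trans (ler_wpM2l (ltW r1') le_sum) _.
  rewrite -opprB mulNr -subrX1 opprB lerBlDr lerDl; exact: X0.
rewrite -(ler_pM2l r1') -(ler_pM2r (x := M%:R)).
  apply: le_trans (_ : 1 <= _); first by rewrite -mulrA [_ * M%:R]mulrC.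
  by rewrite -ler_pdivrMl ?mulr1 ?ltW // mulr_gt0.
by rewrite ltr0n expn_gt0.
Qed.

(** * Noise stability: reduction to small noise and the bound there *)

Section Stability.
Context {R : realType} {n : nat} {T : 'I_n -> finType}.
Variable nu : forall i : 'I_n, T i -> R.
Arguments kE {R n T} nu.
Arguments kT {R n T} nu rho.
Implicit Types (x y : prodsp T) (i : 'I_n) (s : seq 'I_n) (f g : prodsp T -> R).

Lemma opseq_kE_enum f x : opseq (kE nu) (enum 'I_n) f x = \sum_y prodw nu y * f y.
Proof.
rewrite opseqE ?enum_uniq //; apply: eq_big => [y|y _].
  by apply/forallP => i; rewrite mem_enum.
by rewrite big_enum.
Qed.

Lemma opseq_kT_enum rho f : opseq (kT nu rho) (enum 'I_n) f = noiseT nu rho f.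
Proof.
apply/funext => x; rewrite opseqE ?enum_uniq //; apply: eq_big => [y|y _].
  by apply/forallP => i; rewrite mem_enum.
by rewrite big_enum.
Qed.

Lemma opseq_kE_restr s f x : uniq s ->
  opseq (kE nu) s (fun y => f y ^+ 2) x = restr_norm2 nu f [set i | i \notin s] x.
Proof.
move=> us; rewrite opseqE //; apply: eq_big => [y|y _].
  by apply: eq_forallb => i; rewrite inE.
rewrite big_uniq //=; congr (_ * _); apply: eq_bigl => i.
by rewrite inE negbK.
Qed.

Lemma noise_reversible rho x y :
  prodw nu x * noise_kernel nu rho x y = prodw nu y * noise_kernel nu rho y x.
Proof.
rewrite -!big_split /=; apply: eq_bigr => i _; rewrite [y i == _]eq_sym.
have [->|_] := eqVneq (x i) (y i) => //.
by rewrite mulr0 !add0r mulrCA [RHS]mulrCA [nu i (x i) * _]mulrC.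
Qed.

Lemma noiseT_adjoint rho f g :
  \sum_x prodw nu x * (f x * noiseT nu rho g x) =
  \sum_x prodw nu x * (noiseT nu rho f x * g x).
Proof.
under eq_bigr do rewrite /noiseT !mulr_sumr.
rewrite exchange_big /=; apply: eq_bigr => y _.
rewrite /noiseT mulr_suml mulr_sumr; apply: eq_bigr => x _.
transitivity (prodw nu x * noise_kernel nu rho x y * (f x * g y)); first by ring.
by rewrite noise_reversible; ring.
Qed.

Hypothesis hnu : is_prob_family nu.

(** Averaging is idempotent, so the square of [rho + (1 - rho) * E] is
    [rho ^+ 2 + (1 - rho ^+ 2) * E]. *)
Lemma cop_kT_sqr rho i f :
  cop (kT nu rho) i (cop (kT nu rho) i f) = cop (kT nu (rho ^+ 2)) i f.
Proof.
apply/funext => x; rewrite !cop_kT.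
rewrite cop_linear.
rewrite (cop_kE_indep nu hnu i (cop (kE nu) i f)); first by ring.
by move=> t; exact: cop_kE_upd.
Qed.

Lemma noiseT_sqr rho f :
  noiseT nu rho (noiseT nu rho f) = noiseT nu (rho ^+ 2) f.
Proof.
rewrite -!opseq_kT_enum; elim: (enum 'I_n) (enum_uniq 'I_n) => //= i s IH.
move=> /andP[si us]; rewrite -(cop_opseq (kT nu rho) (kT nu rho)) // cop_kT_sqr.
by rewrite IH.
Qed.

Lemma opseq_kE_cst s (a : R) : opseq (kE nu) s (fun=> a) = fun=> a.
Proof.
elim: s => //= i s ->; apply/funext => x; exact: cop_kE_indep.
Qed.

Lemma prodw_ge0 x : 0 <= prodw nu x.
Proof. by apply: prodr_ge0 => i _; case: (hnu i). Qed.

(** Cauchy-Schwarz on the pairing of [f] with its noisy version, whose squared norm is [Stab] at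
    [rho ^+ 2] by self-adjointness and [noiseT_sqr]. *)
Lemma Stab_sqr_le rho f :
  Stab nu rho f ^+ 2 <= (\sum_x prodw nu x * f x ^+ 2) * Stab nu (rho ^+ 2) f.
Proof.
apply: le_trans (weighted_cauchy_schwarz _ _ _ _ _ prodw_ge0) _.
rewrite /Stab -noiseT_sqr (noiseT_adjoint rho f (noiseT nu rho f)) le_eqVlt; apply/orP; left; apply/eqP.
by congr (_ * _); apply: eq_bigr => x _; rewrite expr2.
Qed.

Lemma Stab_ge0 rho f : 0 <= rho -> rho <= 1 -> (forall x, 0 <= f x) ->
  0 <= Stab nu rho f.
Proof.
move=> r0 r1 f0; apply: sumr_ge0 => x _; rewrite !mulr_ge0 ?prodw_ge0 //.
rewrite -opseq_kT_enum; apply: opseq_ge0 => //; exact: kT_ge0.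
Qed.

(** Iterates [Stab_sqr_le]. The extra factor [eps] on both sides avoids the exponent [2 ^ m - 1]. *)
Lemma Stab_power_le rho f (eps : R) m : 0 <= rho -> rho <= 1 ->
  (forall x, 0 <= f x) -> \sum_x prodw nu x * f x ^+ 2 <= eps -> 
  eps * Stab nu rho f ^+ (2 ^ m) <= eps ^+ (2 ^ m) * Stab nu (rho ^+ (2 ^ m)) f.
Proof.
move=> r0 r1 f0 Ae.
have e0 : 0 <= eps.
  by apply: le_trans Ae; apply: sumr_ge0 => x _; rewrite mulr_ge0 ?prodw_ge0 ?sqr_ge0.
elim: m rho r0 r1 => [|m IH] rho r0 r1; first by rewrite !expr1.
have r20 : 0 <= rho ^+ 2 by rewrite sqr_ge0.
have r21 : rho ^+ 2 <= 1 by rewrite expr_le1.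
rewrite expnS !exprM.
have h : Stab nu rho f ^+ 2 <= eps * Stab nu (rho ^+ 2) f.
  by apply: le_trans (Stab_sqr_le _ _) _; rewrite ler_wpM2r // Stab_ge0.
apply: le_trans (_ : eps * (eps * Stab nu (rho ^+ 2) f) ^+ (2 ^ m) <= _).
  by rewrite ler_wpM2l // lerXn2r // nnegrE ?sqr_ge0 // mulr_ge0 // Stab_ge0.
rewrite exprMn mulrCA expr2 exprMn -mulrA ler_wpM2l ?exprn_ge0 //.
exact: IH.
Qed.

Lemma Stab_small_noise (K rho : R) f (eps : R) :
  0 <= K -> rho ^+ 2 <= 1 / 8 -> 12 * (K + 1) * rho ^+ 4 <= 1 ->
  (forall x, f x = 0 \/ f x = 1) ->
  restr_bounded nu K (enum 'I_n) (fun x => f x ^+ 2) eps ->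
  forall x0 : prodsp T, Stab nu rho f ^+ 4 <= eps ^+ 5.
Proof.
move=> K0 hr hK f01 H x0.
have fsq x : f x * f x = f x by case: (f01 x) => ->; rewrite ?mulr0 ?mulr1.
set A := \sum_x prodw nu x * f x ^+ 2.
have A0 : 0 <= A by apply: sumr_ge0 => x _; rewrite mulr_ge0 ?prodw_ge0 ?sqr_ge0.
have Ae : A <= eps.
  by have := H _ (subseq_refl _) x0; rewrite subnn mul1r opseq_kE_enum.
have e0 := le_trans A0 Ae.
set F := noiseT nu rho f.
have four : \sum_x prodw nu x * (F x ^+ 2) ^+ 2 <= eps * A.
  (* The family is the single function [f] with weight 1. *)
  have H1 : restr_bounded nu K (enum 'I_n) (fun x => \sum_(j : unit) 1 * f x ^+ 2) eps.
    apply: restr_bounded_le H => // x.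
    by rewrite big_const card_unit /= mul1r addr0.
  have := noise_product_bound nu hnu K rho K0 hr hK _ (enum_uniq 'I_n)
    unit (fun=> 1) (fun=> f) f eps (fun=> ler01) H1 x0.
  rewrite opseq_kT_enum !opseq_kE_enum; apply: le_trans.
  apply: ler_sum => x _; rewrite ler_wpM2l ?prodw_ge0 //.
  by rewrite big_const card_unit /= mul1r addr0 -expr2.
set B := \sum_x prodw nu x * (f x * F x ^+ 2).
have B0 : 0 <= B.
  apply: sumr_ge0 => x _; rewrite mulr_ge0 ?prodw_ge0 // mulr_ge0 ?sqr_ge0 //.
  by rewrite -fsq -expr2 sqr_ge0.
have SB : Stab nu rho f ^+ 2 <= A * B.
  (* Since [f] equals its square, a copy of [f] stays inside [B]; the second Cauchy-Schwarz, for
     [BB], then gains another factor [A]. *)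
  have -> : Stab nu rho f = \sum_x prodw nu x * (f x * (f x * F x)).
    by apply: eq_bigr => x _; rewrite [f x * (f x * _)]mulrA fsq.
  apply: le_trans (weighted_cauchy_schwarz _ _ _ _ _ prodw_ge0) _.
  rewrite ler_wpM2l //; apply: ler_sum => x _.
  by rewrite exprMn [f x ^+ 2]expr2 fsq.
have BB : B ^+ 2 <= A * (eps * A).
  apply: le_trans (weighted_cauchy_schwarz _ _ _ _ _ prodw_ge0) _.
  by rewrite ler_wpM2l.
apply: le_trans (_ : (A * B) ^+ 2 <= _).
  rewrite -[4%N]/(2 * 2)%N exprM lerXn2r // nnegrE ?sqr_ge0 //.
  exact: mulr_ge0.
rewrite exprMn; apply: le_trans (ler_wpM2l (sqr_ge0 A) BB) _.
have -> : A ^+ 2 * (A * (eps * A)) = eps * A ^+ 4 by ring.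
by rewrite [eps ^+ 5]exprS ler_wpM2l // lerXn2r // nnegrE.
Qed.

(* A restriction of a Boolean function has norm at most 1, and beyond
   [ln (1 / mu)] fixed coordinates the factor [e ^ #|S|] exceeds [1 / mu]; so
   globalness yields a bound on restrictions of every size. *)
Lemma is_global_restr_bounded f (mu c : R) :
  (forall x, f x = 0 \/ f x = 1) -> 0 < mu -> mu <= 1 -> 0 <= c ->
  is_global nu (ln (mu^-1)) (mu `^ (1 - c)) f ->
  restr_bounded nu (expR 1) (enum 'I_n) (fun x => f x ^+ 2) (mu `^ (1 - c)).
Proof.
move=> f01 mu0 mu1 c0 H s s_enum x.
have us : uniq s := subseq_uniq s_enum (enum_uniq _).
set S := [set i | i \notin s].
have cS : (size s + #|S|)%N = n.
  rewrite -(card_uniqP us) -[RHS]card_ord -(cardC (mem s)); congr (_ + _)%N.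
  by apply: eq_card => i; rewrite !inE.
rewrite size_enum_ord.
have <- : #|S| = (n - size s)%N by rewrite -(addKn (size s) #|S|) cS.
have e0 : 0 <= mu `^ (1 - c) by exact: powR_ge0.
rewrite -expRM_natl mulr1.
have [small|large] := leP (#|S|%:R : R) (ln mu^-1).
  rewrite opseq_kE_restr //; apply: le_trans (H _ small x) _.
  by apply: ler_peMl => //; rewrite -[leLHS]expR0 ler_expR.
apply: le_trans (_ : opseq (kE nu) s (fun=> 1) x <= _).
  apply: le_opseq => [|y]; first exact: kE_ge0.
  by case: (f01 y) => ->; rewrite ?expr0n ?expr1n.
(* The bound 1 is split as [mu^-1 * mu], with [mu^-1] below the exponential and [mu] below its power
   of exponent [1 - c]. *)
rewrite opseq_kE_cst; apply: le_trans (_ : mu^-1 * mu <= _).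
  by rewrite mulVf ?gt_eqF.
apply: ler_pM; rewrite ?invr_ge0 ?(ltW mu0) //.
  by rewrite -[leLHS]lnK ?posrE ?invr_gt0 // ler_expR ltW.
rewrite -[leLHS](powRr1 (ltW mu0)); apply: ger_powR; last by rewrite gerBl.
by rewrite mu0.
Qed.

End Stability.

(** * Choice of the exponent and conclusion *)

Theorem theorem5p14 (R : realType) (rho : R) (hrho0 : 0 <= rho) (hrho1 : rho < 1) :
  exists c : R, 0 < c /\
    forall (n : nat) (T : 'I_n -> finType) (nu : forall i : 'I_n, T i -> R)
           (f : prodsp T -> R) (mu : R),
      is_prob_family nu ->
      (forall x, f x = 0 \/ f x = 1) ->
      0 < mu -> mu < 1 / 16 ->
      is_global nu (ln (mu^-1)) (mu `^ (1 - c)) f ->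
      Stab nu rho f <= mu `^ (1 + c).
Proof.
have K0 : 0 <= expR 1 :> R := expR_ge0 1.
(* One threshold serves both smallness conditions: it is at most [1 / 8], and positive powers of
   [rho ^+ M] stay below it. *)
have d0 : 0 < (12 * (expR 1 + 1))^-1 :> R.
  by rewrite invr_gt0 mulr_gt0 // ltr_wpDl.
have [m hm] := small_power_of_two_power R rho _ hrho0 hrho1 d0.
set M := (2 ^ m)%N in hm; set N := (M * 4)%N.
have N0 : (0 < N)%N by rewrite muln_gt0 expn_gt0.
have rM0 : 0 <= rho ^+ M by rewrite exprn_ge0.
have rM1 : rho ^+ M <= 1 by rewrite exprn_ile1 // ltW.
have rMX k : (rho ^+ M) ^+ k.+1 <= (12 * (expR 1 + 1))^-1.
  by apply: le_trans hm; rewrite exprS ler_piMr // exprn_ile1.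
have hr2 : (rho ^+ M) ^+ 2 <= 1 / 8.
  apply: le_trans (rMX 1%N) _; rewrite div1r lef_pV2 ?posrE //; first by lra.
  by rewrite mulr_gt0 // ltr_wpDl.
have hr4 : 12 * (expR 1 + 1) * (rho ^+ M) ^+ 4 <= 1.
  by rewrite -ler_pdivlMl ?mulr1 ?rMX // mulr_gt0 // ltr_wpDl.
have N2 : 0 < (2 * N)%:R + 1 :> R by rewrite ltr_wpDl.
(* This [c] solves [(1 - c) * (N + 1) = (1 + c) * N], which turns [eps ^+ N.+1] into the [N]-th
   power of the target. *)
exists ((2 * N)%:R + 1)^-1; split; first by rewrite invr_gt0.
move=> n T nu f mu hnu f01 mu0 mu16 H.
set c : R := ((2 * N)%:R + 1)^-1 in H *.
have c0 : 0 < c by rewrite invr_gt0.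
have mu1 : mu <= 1 by lra.
(* The restriction bounds are evaluated at a point; with no point available, [Stab] is an empty
   sum. *)
have [x0 _|no] := pickP (fun _ : prodsp T => true); last first.
  by rewrite /Stab big_pred0 ?powR_ge0 // => x; have := no x.
have Hb := is_global_restr_bounded nu hnu f mu c f01 mu0 mu1 (ltW c0) H.
set eps := mu `^ (1 - c) in Hb.
have e0 : 0 < eps by exact: powR_gt0.
have f0 x : 0 <= f x by case: (f01 x) => ->.
have Ae : \sum_x prodw nu x * f x ^+ 2 <= eps.
  by have := Hb _ (subseq_refl _) x0; rewrite subnn mul1r opseq_kE_enum.
have small := Stab_small_noise nu hnu _ _ f eps K0 hr2 hr4 f01 Hb x0.
have S0 : 0 <= Stab nu rho f by apply: Stab_ge0 => //; exact: ltW.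
have SM0 : 0 <= Stab nu (rho ^+ M) f by apply: Stab_ge0.
have power : Stab nu rho f ^+ N <= eps ^+ N.+1.
  have := Stab_power_le nu hnu rho f eps m hrho0 (ltW hrho1) f0 Ae.
  rewrite -/M => /(lerXn2r 4%N); rewrite !nnegrE.
  rewrite !mulr_ge0 ?exprn_ge0 ?(ltW e0) // => /(_ isT isT).
  (* The fourth power of the iterated bound, combined with [small], has [eps ^+ (N + 5)] on the
     right; the factor [eps ^+ 4] cancels. *)
  rewrite !exprMn -!exprM -/N => h; rewrite -(ler_pM2l (exprn_gt0 4 e0)).
  apply: le_trans h _; rewrite -exprD addnC addSnnS exprD.
  by rewrite ler_wpM2l // exprn_ge0 // ltW.
rewrite -(ler_pXn2r N0) ?nnegrE ?powR_ge0 //; apply: le_trans power _.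
rewrite -!powR_mulrn ?powR_ge0 // /eps -!powRrM.
have -> : (1 - c) * N.+1%:R = (1 + c) * N%:R :> R.
  have : c * ((2 * N)%:R + 1) = 1 by rewrite mulVf // gt_eqF.
  by rewrite natrM -natr1; lra.
exact: lexx.
Qed.
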